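(* Let $G=(V,E)$ be a connected undirected graph with $V=\{1,\dots,N\}$, $N\ge 2$, let $(\mathcal{M},d)$ be a complete $CAT(0)$ metric space, and let $X_k=(X_v(k))_{v\in V}\in\mathcal{M}^N$, $k\ge 0$, be the sequence generated by the Random Pairwise Midpoint algorithm (defined in the context) from an initial configuration $X_0\in\mathcal{M}^N$. Then there exists a random variable $X_\infty=(X_{\infty,v})_{v\in V}$ with values in $\mathcal{M}^N$ such that: (i) almost surely, $X_{\infty,v}=X_{\infty,w}$ for all $(v,w)\in V^2$; and (ii) $X_k$ converges almost surely to $X_\infty$ as $k\to\infty$.
   Context: Graph: $E$ is a set of unordered pairs $\{v,w\}$ of distinct elements of $V$; $v\sim w$ means $\{v,w\}\in E$; $\deg(v)$ is the number of neighbors of $v$. $CAT(0)$ space: a geodesic in $(\mathcal{M},d)$ is a map $c:[0,l]\to\mathcal{M}$ with $d(c(t),c(t'))=|t-t'|$ for all $t,t'\in[0,l]$; it joins $c(0)$ to $c(l)$. $(\mathcal{M},d)$ is $CAT(0)$ if any two points are joined by a geodesic and for every geodesic triangle with vertices $p,q,r$ (three points and three geodesic segments joining them), every point $x$ on the side from $p$ to $q$ and every point $y$ on the side from $p$ to $r$, one has $d(x,y)\le\|\bar x-\bar y\|$, where $\bar p,\bar q,\bar r$ is a comparison triangle in the Euclidean plane ($\|\bar p-\bar q\|=d(p,q)$, $\|\bar q-\bar r\|=d(q,r)$, $\|\bar r-\bar p\|=d(r,p)$), $\bar x\in[\bar p,\bar q]$ satisfies $\|\bar p-\bar x\|=d(p,x)$,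 and $\bar y\in[\bar p,\bar r]$ satisfies $\|\bar p-\bar y\|=d(p,y)$. In a $CAT(0)$ space any two points $x,y$ have a unique midpoint $\left\langle\frac{x+y}{2}\right\rangle$, i.e. a unique point $m$ with $d(x,m)=d(y,m)=d(x,y)/2$. Random Pairwise Midpoint algorithm: let $(V_k,W_k)_{k\ge 0}$ be i.i.d. random variables with values in $V\times V$ such that $\mathbb{P}[\{V_k,W_k\}=\{v,w\}]=\frac1N\left(\frac1{\deg(v)}+\frac1{\deg(w)}\right)$ if $v\sim w$ and $0$ otherwise, and such that $(V_k,W_k)$ is independent of $X_0,\dots,X_{k-1},(V_0,W_0),\dots,(V_{k-1},W_{k-1})$. The initial configuration $X_0=(X_v(0))_{v\in V}\in\mathcal{M}^N$ is given (deterministic). For each $k\ge1$, set $X_{V_k}(k)=X_{W_k}(k)=\left\langle\frac{X_{V_k}(k-1)+X_{W_k}(k-1)}{2}\right\rangle$ and $X_v(k)=X_v(k-1)$ for $v\notin\{V_k,W_k\}$. *)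

(* Defs.v *)
From HB Require Import structures.
From mathcomp Require Import all_boot all_order all_algebra finmap.
From mathcomp Require Import all_classical all_reals all_analysis.

Set Implicit Arguments.
Unset Strict Implicit.
Unset Printing Implicit Defensive.

Import Order.TTheory GRing.Theory Num.Theory.

Local Open Scope classical_set_scope.
Local Open Scope ring_scope.

Definition degree (N : nat) (e : rel 'I_N) (v : 'I_N) : nat :=
  #|[pred w | e v w]|.

(* The library norm on row vectors is the sup norm, hence the explicit
   Euclidean norm. *)
Definition enorm (R : realType) (x : 'rV[R]_2) : R :=
  Num.sqrt (\sum_(i < 2) x 0 i ^+ 2).

Definition esegment (R : realType) (a b : 'rV[R]_2) : set 'rV[R]_2 :=
  [set (1 - s) *: a + s *: b | s in `[0, 1]].

Definition complete_metric (R : realType) (M : metricType R) : Prop :=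
  forall u : nat -> M, cauchy (u @ \oo) -> exists l : M, u @ \oo --> l.

(* Only the restriction of [c] to [0, l] matters. *)
Definition geodesic (R : realType) (M : metricType R) (x y : M) (l : R)
    (c : R -> M) : Prop :=
  [/\ 0 <= l,
      {in `[0, l] &, forall t t', mdist (c t) (c t') = `|t - t'|},
      c 0 = x & c l = y].

Definition geodesic_segment (R : realType) (M : metricType R) (x y : M)
    (S : set M) : Prop :=
  exists (l : R) (c : R -> M), geodesic x y l c /\ S = c @` `[0, l].

Definition cat0 (R : realType) (M : metricType R) : Prop :=
  (forall x y : M, exists (l : R) (c : R -> M), geodesic x y l c) /\
  (forall (p q r : M) (pq pr qr : set M),
    geodesic_segment p q pq -> geodesic_segment p r pr ->
    geodesic_segment q r qr ->
    forall x y : M, pq x -> pr y ->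
    forall p' q' r' x' y' : 'rV[R]_2,
      enorm (p' - q') = mdist p q ->
      enorm (q' - r') = mdist q r ->
      enorm (r' - p') = mdist r p ->
      esegment p' q' x' -> enorm (p' - x') = mdist p x ->
      esegment p' r' y' -> enorm (p' - y') = mdist p y ->
      mdist x y <= enorm (x' - y')).

(* In a CAT(0) space the set below is a singleton, so that the default value
   [x] of [xget] is never used. *)
Definition midpoint (R : realType) (M : metricType R) (x y : M) : M :=
  xget x [set m | mdist x m = mdist x y / 2 /\ mdist y m = mdist x y / 2].

(* The pair [s 0] is not used: step k >= 1 uses the pair of index k. *)
Fixpoint pairwise_midpoint (R : realType) (M : metricType R) (N : nat)
    (x0 : 'I_N -> M) (s : nat -> 'I_N * 'I_N) (k : nat) : {ptws 'I_N -> M} :=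
  if k is k'.+1 then
    let x := pairwise_midpoint x0 s k' in
    fun u => if (u == (s k).1) || (u == (s k).2)
             then midpoint (x (s k).1) (x (s k).2) else x u
  else x0.

Definition borel (S : topologicalType) : set_system S := <<s @open S >>.

(* [G] is the sigma-algebra of the value space of [Y]. *)
Definition is_random_variable (d : measure_display) (T : measurableType d)
    (S : Type) (G : set_system S) (Y : T -> S) : Prop :=
  forall B, G B -> measurable (Y @^-1` B).
Arguments is_random_variable {d T S} G Y.

(* Mutual independence and identical distribution, for the discrete
   sigma-algebra on the value space. *)
Definition iid (R : realType) (d : measure_display) (T : measurableType d)
    (P : probability T R) (S : Type) (Y : nat -> T -> S) : Prop :=
  (forall (J : {fset nat}) (A : nat -> set S),
    P (\bigcap_(j in [set` J]) (Y j @^-1` A j)) =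
    (\prod_(j <- J) P (Y j @^-1` A j))%E) /\
  (forall (j k : nat) (A : set S), P (Y j @^-1` A) = P (Y k @^-1` A)).

(* The sigma-algebra generated by X_0, ..., X_{k-1}, with Borel values, and
   E_0, ..., E_{k-1}, with discrete values. *)
Definition past (T : Type) (S : topologicalType) (S' : Type)
    (X : nat -> T -> S) (E : nat -> T -> S') (k : nat) : set_system T :=
  <<s [set F | exists2 i, (i < k)%N &
         (exists2 B, borel B & F = X i @^-1` B) \/
         (exists A, F = E i @^-1` A)] >>.

Definition independent_of (R : realType) (d : measure_display)
    (T : measurableType d) (P : probability T R) (S : Type) (Y : T -> S)
    (G : set_system T) : Prop :=
  forall (A : set S) (F : set T), G F ->
    P (Y @^-1` A `&` F) = (P (Y @^-1` A) * P F)%E.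

(* Main.v *)
(** The CN inequality d(m,z)^2 <= (d(x,z)^2 + d(y,z)^2)/2 - d(x,y)^2/4 for the
    midpoint m of x and y, read off a comparison triangle, has two consequences.
    Balls are convex, so once all X_v(k) lie in a ball they stay there; and for
    fixed z the energy \sum_v d(X_v(k), z)^2 drops by at least half the squared
    distance of the two averaged points, so that this distance (the gap) tends
    to 0.  By independence, almost surely there are infinitely many blocks of
    consecutive steps that use every edge, in a fixed order.  During a late
    block all gaps are at most r, hence no point moves by more than a constant
    times r and every pair of neighbours is at some time within r: at the start
    of the block the configuration has diameter O(r), by connectedness.  Since
    balls are convex, the orbits are Cauchy with a common limit. *)

Require Import Defs.
From HB Require Import structures.
From mathcomp Require Import all_boot all_order all_algebra finmap.
From mathcomp Require Import all_classical all_reals all_analysis.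
From mathcomp Require Import ring lra.

Set Implicit Arguments.
Unset Strict Implicit.
Unset Printing Implicit Defensive.

Import Order.TTheory GRing.Theory Num.Theory.
Import numFieldNormedType.Exports.

Local Open Scope classical_set_scope.
Local Open Scope ring_scope.

(** * The Euclidean plane and comparison triangles *)

Lemma enorm_sqr (R : realType) (x : 'rV[R]_2) :
  enorm x ^+ 2 = x 0 0 ^+ 2 + x 0 1 ^+ 2.
Proof.
rewrite /enorm sqr_sqrtr; last by apply: sumr_ge0 => i _; exact: sqr_ge0.
rewrite big_ord_recl big_ord1.
by congr (_ + x 0 _ ^+ 2); apply/val_inj.
Qed.

Lemma enorm_ge0 (R : realType) (x : 'rV[R]_2) : 0 <= enorm x.
Proof. exact: sqrtr_ge0. Qed.

Lemma enormE (R : realType) (x : 'rV[R]_2) (r : R) :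
  0 <= r -> x 0 0 ^+ 2 + x 0 1 ^+ 2 = r ^+ 2 -> enorm x = r.
Proof.
move=> r0 xr; apply/eqP; rewrite -(@eqrXn2 _ 2)// ?enorm_sqr ?xr//.
exact: enorm_ge0.
Qed.

Definition vec2 (R : realType) (a b : R) : 'rV[R]_2 :=
  \row_(j < 2) if j == 0 then a else b.

(** With the side of length [a] laid on the first axis from the origin, [(u, v)] is the apex: [u]
    comes from the law of cosines, and the triangle inequalities make the radicand for [v]
    nonnegative. *)
Lemma comparison_triangle (R : realType) (a b c : R) :
  0 < a -> 0 <= b -> 0 <= c -> a <= b + c -> b <= a + c -> c <= a + b ->
  exists u v : R,
    u ^+ 2 + v ^+ 2 = b ^+ 2 /\ (u - a) ^+ 2 + v ^+ 2 = c ^+ 2.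
Proof.
move=> a0 b0 c0 abc bac cab.
pose u := (a ^+ 2 + b ^+ 2 - c ^+ 2) / (2 * a).
have ua : 2 * a * u = a ^+ 2 + b ^+ 2 - c ^+ 2.
  by rewrite /u; field; rewrite gt_eqF.
(* Heron's formula *)
have ub : u ^+ 2 <= b ^+ 2.
  rewrite -(@ler_pM2l _ (4 * a ^+ 2)) ?mulr_gt0 ?exprn_gt0//.
  have -> : 4 * a ^+ 2 * u ^+ 2 = (2 * a * u) ^+ 2 by ring.
  rewrite ua -subr_ge0.
  have -> : 4 * a ^+ 2 * b ^+ 2 - (a ^+ 2 + b ^+ 2 - c ^+ 2) ^+ 2 =
    ((b + c - a) * (a + c - b)) * ((a + b - c) * (a + b + c)) by ring.
  by rewrite !mulr_ge0//; lra.
exists u, (Num.sqrt (b ^+ 2 - u ^+ 2)).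
rewrite sqr_sqrtr ?subr_ge0//; split; first by ring.
have -> : (u - a) ^+ 2 = u ^+ 2 + a ^+ 2 - 2 * a * u by ring.
by rewrite ua; ring.
Qed.

(** * Midpoints in CAT(0) spaces *)

Section cat0_midpoint.
Context (R : realType) (M : metricType R) (M_cat0 : cat0 M).
Implicit Types x y z m : M.

Lemma geodesic_length x y l c : geodesic x y l c -> l = mdist x y.
Proof.
move=> [l0 iso <- <-].
by rewrite iso ?sub0r ?normrN ?ger0_norm// in_itv/= ?lexx ?l0.
Qed.

Lemma geodesic_segmentP x y : exists S, geodesic_segment x y S.
Proof.
have [l [c cxy]] := M_cat0.1 x y.
by exists (c @` `[0, l]), l, c.
Qed.

Lemma geodesic_segmentr x y S : geodesic_segment x y S -> S y.
Proof.
move=> [l [c [[l0 iso cx cy] ->]]].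
by exists l => //; rewrite /= in_itv/= l0 lexx.
Qed.

(* CAT(0) inequality for m on the side [x, y] and the vertex z on the side
   [x, z]. *)
Lemma cat0_median x y z S m : geodesic_segment x y S -> S m ->
  mdist x m = mdist x y / 2 ->
  mdist m z ^+ 2 <=
    (mdist x z ^+ 2 + mdist y z ^+ 2) / 2 - mdist x y ^+ 2 / 4.
Proof.
move=> Sxy Sm xm.
(* The case [x = y] is treated apart, since the apex formula divides by [mdist x y]. *)
have := mdist_ge0 x y; rewrite le_eqVlt => /predU1P[xy0|xy0].
  move: xm; rewrite -xy0 mul0r => /mdist_positivity <-.
  by rewrite -(mdist_positivity _ _ (esym xy0)); lra.
have [u [v [xz yz]]] : exists u v : R,
    u ^+ 2 + v ^+ 2 = mdist x z ^+ 2 /\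
    (u - mdist x y) ^+ 2 + v ^+ 2 = mdist y z ^+ 2.
  apply: comparison_triangle => //; rewrite ?mdist_ge0//.
  - by rewrite (metric_sym y z) metric_triangle.
  - exact: metric_triangle.
  - by rewrite (metric_sym x y) metric_triangle.
have [T Txz] := geodesic_segmentP x z.
have [U Uyz] := geodesic_segmentP y z.
(* The comparison triangle has [x] at the origin and [y] on the first axis, which turns the bound
   into a computation in coordinates. *)
have := M_cat0.2 x y z S T U Sxy Txz Uyz m z Sm (geodesic_segmentr Txz)
  (vec2 0 0) (vec2 (mdist x y) 0) (vec2 u v) (vec2 (mdist x y / 2) 0)
  (vec2 u v).
rewrite -(@ler_sqr _ (mdist m z)) ?nnegrE ?mdist_ge0 ?enorm_ge0// enorm_sqr.
move=> main; apply: le_trans (main _ _ _ _ _ _ _) _.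
- apply: enormE; first exact: mdist_ge0.
  by rewrite !mxE/=; ring.
- apply: enormE; first exact: mdist_ge0.
  by rewrite !mxE/= -yz; ring.
- apply: enormE; first exact: mdist_ge0.
  by rewrite !mxE/= metric_sym -xz; ring.
- exists (2^-1); first by rewrite /= in_itv/=; apply/andP; split; lra.
  by apply/rowP => i; rewrite !mxE; case: ifP => _; lra.
- apply: enormE; first exact: mdist_ge0.
  by rewrite !mxE/= xm; field.
- exists 1; first by rewrite /= in_itv/= ler01 lexx.
  by rewrite subrr scale0r add0r scale1r.
- apply: enormE; first exact: mdist_ge0.
  by rewrite !mxE/= -xz; ring.
- by rewrite !mxE/= -xz -yz le_eqVlt; apply/orP; left; apply/eqP; field.
Qed.

Lemma geodesic_midpoint x y : exists S m,
  [/\ geodesic_segment x y S, S m, mdist x m = mdist x y / 2 &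
      mdist y m = mdist x y / 2].
Proof.
have [l [c cxy]] := M_cat0.1 x y.
have lE := geodesic_length cxy.
have [l0 iso cx cy] := cxy.
have h : l / 2 \in `[0, l] by rewrite in_itv/=; apply/andP; split; lra.
exists (c @` `[0, l]), (c (l / 2)); split.
- by exists l, c.
- by exists (l / 2).
- rewrite -cx iso ?in_itv/= ?lexx ?l0// ?sub0r ?normrN ?ger0_norm//; try lra.
  by rewrite cx lE.
- rewrite -{1}cy iso//; last by rewrite in_itv/= l0 lexx.
  by rewrite ger0_norm; lra.
Qed.

Lemma midpointP x y :
  mdist x (midpoint x y) = mdist x y / 2 /\
  mdist y (midpoint x y) = mdist x y / 2.
Proof.
have [S [m [_ _ xm ym]]] := geodesic_midpoint x y.
have := @xgetPex _ x [set m | mdist x m = mdist x y / 2 /\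
  mdist y m = mdist x y / 2].
by apply; exists m.
Qed.

(** A geodesic midpoint [m] obeys the inequality by [cat0_median]. Taking the chosen midpoint as [z]
    there makes the right-hand side 0, so the two points coincide. *)
Lemma midpoint_ineq x y z :
  mdist (midpoint x y) z ^+ 2 <=
    (mdist x z ^+ 2 + mdist y z ^+ 2) / 2 - mdist x y ^+ 2 / 4.
Proof.
have [S [m [Sxy Sm xm ym]]] := geodesic_midpoint x y.
have [xm' ym'] := midpointP x y.
suff -> : midpoint x y = m by exact: cat0_median Sxy Sm xm.
apply/esym/mdist_positivity/eqP; rewrite -sqrf_eq0 eq_le sqr_ge0 andbT.
apply: le_trans (cat0_median _ Sxy Sm xm) _.
by rewrite xm' ym'; lra.
Qed.

Lemma midpoint_ball x y z r : mdist x z <= r -> mdist y z <= r ->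
  mdist (midpoint x y) z <= r.
Proof.
move=> xz yz.
have r0 : 0 <= r by rewrite (le_trans _ xz)// mdist_ge0.
rewrite -ler_sqr ?nnegrE ?mdist_ge0//.
apply: le_trans (midpoint_ineq _ _ _) _.
have : mdist x z ^+ 2 <= r ^+ 2 by rewrite ler_sqr ?nnegrE ?mdist_ge0.
have : mdist y z ^+ 2 <= r ^+ 2 by rewrite ler_sqr ?nnegrE ?mdist_ge0.
have := sqr_ge0 (mdist x y).
lra.
Qed.

Lemma midpointxx x : midpoint x x = x.
Proof.
by have [] := midpointP x x; rewrite mdistxx mul0r => /mdist_positivity.
Qed.

End cat0_midpoint.

(** * Deterministic convergence to a consensus *)

Section midpoint_dynamics.
Context (R : realType) (M : metricType R) (M_cat0 : cat0 M).
Context (N : nat) (x0 : 'I_N -> M) (s : nat -> 'I_N * 'I_N).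

Let x := pairwise_midpoint x0 s.

Let gap k := mdist (x k (s k.+1).1) (x k (s k.+1).2).

Let xS k v : x k.+1 v =
  if (v == (s k.+1).1) || (v == (s k.+1).2)
  then midpoint (x k (s k.+1).1) (x k (s k.+1).2) else x k v.
Proof. by []. Qed.

(** Both selected points become the midpoint, so the CN inequality counts twice, whence the factor
    1/2; all other terms are unchanged. *)
Lemma step_energy z k :
  \sum_v mdist (x k.+1 v) z ^+ 2 <=
  \sum_v mdist (x k v) z ^+ 2 - gap k ^+ 2 / 2.
Proof.
rewrite /gap; under eq_bigr do rewrite xS.
case: (s k.+1) => a b /=.
(* A pair with equal entries moves nothing and has gap 0. *)
have [<-|ab] := eqVneq a b.
  rewrite mdistxx expr0n mul0r subr0 le_eqVlt; apply/orP; left; apply/eqP.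
  apply: eq_bigr => v _; rewrite orbb; case: eqP => // ->.
  by rewrite midpointxx.
rewrite (bigD1 a)//= (bigD1 b) 1?eq_sym//= [X in _ <= X - _](bigD1 a)//=.
rewrite [X in _ <= _ + X - _](bigD1 b) 1?eq_sym//= !eqxx orbT/=.
rewrite (eq_bigr (fun v => mdist (x k v) z ^+ 2)); last first.
  by move=> v /andP[/negbTE -> /negbTE ->].
have := midpoint_ineq M_cat0 (x k a) (x k b) z.
lra.
Qed.

Lemma step_ball z r k : (forall v, mdist (x k v) z <= r) ->
  forall j v, mdist (x (k + j) v) z <= r.
Proof.
move=> kr; elim=> [|j IH] v; first by rewrite addn0.
rewrite addnS xS; case: ifP => _; last exact: IH.
by apply: midpoint_ball.
Qed.

Lemma step_displacement k v : mdist (x k v) (x k.+1 v) <= gap k.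
Proof.
rewrite /gap xS; case: (s k.+1) => a b /=.
have [ma mb] := midpointP M_cat0 (x k a) (x k b).
have d0 := mdist_ge0 (x k a) (x k b).
case: (eqVneq v a) => [->|_] /=; first by rewrite ma; lra.
case: (eqVneq v b) => [->|_] /=; first by rewrite mb; lra.
by rewrite mdistxx.
Qed.

(** The energy is nonincreasing and nonnegative, hence Cauchy: consecutive values eventually differ
    by less than [r ^+ 2 / 2], and this difference dominates half the squared gap. *)
Lemma gap_small (z : M) r : 0 < r ->
  exists K, forall k, (K <= k)%N -> gap k <= r.
Proof.
move=> r0.
pose F k := \sum_v mdist (x k v) z ^+ 2.
have F0 k : 0 <= F k by apply: sumr_ge0 => v _; exact: sqr_ge0.
have Fdec k : F k.+1 <= F k - gap k ^+ 2 / 2 by exact: step_energy.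
have Fcvg : cvgn F.
  apply: nonincreasing_is_cvgn.
    apply/nonincreasing_seqP => k; apply: le_trans (Fdec k) _.
    by rewrite gerBl divr_ge0// sqr_ge0.
  by exists 0 => _ [k _ <-].
have /cauchy_cvgP/cauchy_ballP := Fcvg.
move=> /(_ (r ^+ 2 / 2)); rewrite divr_gt0// ?exprn_gt0// => /(_ isT).
move=> [[A B] [[K1 _ HA] [K2 _ HB]] AB]; exists (maxn K1 K2) => k.
rewrite geq_max => /andP[k1 k2].
have /= := AB (F k, F k.+1).
rewrite -ball_normE/= => /(_ (conj (HA _ k1) (HB _ (leqW k2)))).
move=> /(le_lt_trans (ler_norm _)) FF.
rewrite -ler_sqr ?nnegrE ?mdist_ge0//; last exact: ltW.
have := Fdec k; lra.
Qed.

Lemma displacement_bound r k j v : (forall i, (k <= i)%N -> gap i <= r) ->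
  mdist (x k v) (x (k + j) v) <= j%:R * r.
Proof.
move=> gr; elim: j => [|j IH]; first by rewrite addn0 mdistxx mul0r.
rewrite addnS mulrSr mulrDl mul1r.
apply: le_trans (metric_triangle _ (x (k + j) v) _) (lerD IH _).
exact: le_trans (step_displacement _ _) (gr _ (leq_addr _ _)).
Qed.

Context (e : rel 'I_N) (e_conn : forall v w, connect e v w).
Context (L : nat).

(** For an edge, follow [v] until the edge is used, cross the gap, and follow [w] back: the cost is
    at most [L + 1 + L] times [r]. A duplicate-free path has at most [N] edges. *)
Lemma block_diameter r k :
  (forall i, (k <= i)%N -> gap i <= r) ->
  (forall v w, e v w -> exists2 i, (i < L)%N &
     s (k + i).+1 = (v, w) \/ s (k + i).+1 = (w, v)) ->
  forall v w, mdist (x k v) (x k w) <= (N * L.*2.+1)%:R * r.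
Proof.
move=> gr block.
have r0 : 0 <= r by apply: le_trans (gr k (leqnn k)); exact: mdist_ge0.
have edge v w : e v w -> mdist (x k v) (x k w) <= L.*2.+1%:R * r.
  move=> /block[i iL swv].
  have gvw : mdist (x (k + i) v) (x (k + i) w) <= r.
    have := gr (k + i)%N (leq_addr _ _); rewrite /gap.
    by case: swv => -> //=; rewrite metric_sym.
  apply: le_trans (metric_triangle _ (x (k + i) v) _) _.
  apply: le_trans (lerD (displacement_bound _ _ gr)
    (metric_triangle _ (x (k + i) w) _)) _.
  rewrite (metric_sym (x (k + i) w)).
  have := displacement_bound i w gr.
  have : i%:R * r <= L%:R * r by rewrite ler_wpM2r// ler_nat ltnW.
  rewrite -addn1 -mul2n natrD natrM; lra.
move=> v w; have /connectP[p pp ->] := e_conn v w.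
case/shortenP: pp => {}p pp up _.
have pN : (size p <= N)%N.
  by have := max_card (mem (v :: p)); rewrite (card_uniqP up) card_ord => /ltnW.
apply: le_trans (_ : (size p * L.*2.+1)%:R * r <= _); last first.
  by rewrite ler_wpM2r// ler_nat leq_mul2r pN orbT.
elim: p v pp {up pN} => [|u p IH] v /=; first by rewrite mdistxx mul0n mul0r.
move=> /andP[vu up]; rewrite mulSn natrD mulrDl.
apply: le_trans (metric_triangle _ (x k u) _) _.
by rewrite lerD// ?edge// IH.
Qed.

Lemma midpoint_consensus (M_complete : complete_metric M) :
  (forall n, exists2 k, (n <= k)%N & forall v w, e v w ->
     exists2 i, (i < L)%N &
       s (k + i).+1 = (v, w) \/ s (k + i).+1 = (w, v)) ->
  forall v0 : 'I_N, exists l : M, forall v, (fun k => x k v) @ \oo --> l.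
Proof.
move=> blocks v0.
have small r : 0 < r ->
    exists k, forall j v w, mdist (x (k + j) v) (x k w) <= r.
  (* Gaps of at most [r / c] give a diameter of at most [r]; adding 1 keeps the divisor positive. *)
  move=> r0; pose c : R := (N * L.*2.+1)%:R + 1.
  have c0 : 0 < c by rewrite ltr_wpDl.
  have [K gK] := gap_small (x0 v0) (divr_gt0 r0 c0).
  have [k Kk block] := blocks K.
  (* The ball around [x k w] holds the configuration at time [k], hence at all later times. *)
  exists k => j v w; apply: step_ball => {}v.
  apply: le_trans (block_diameter (r := r / c) _ block v w) _.
    by move=> i ki; apply: gK; exact: leq_trans ki.
  rewrite mulrCA ger_pMr// ler_pdivrMr// mul1r.
  by rewrite lerDl.
have [l xl] : exists l : M, (fun k => x k v0) @ \oo --> l.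
  apply: M_complete; apply: cauchy_exP => r r0.
  have [k kr] := small (r / 2) (divr_gt0 r0 (ltr0Sn _ 1)).
  exists (x k v0); exists k => // i /= ki; rewrite ballEmdist/=.
  rewrite metric_sym -(subnKC ki); apply: le_lt_trans (kr _ _ _) _; lra.
exists l => v; apply/metricType_numDomainType.cvgrPdist_lt => r r0.
have [k kr] := small (r / 4) (divr_gt0 r0 (ltr0Sn _ 3)).
have [K _ lK] := metricType_numDomainType.cvgr_dist_lt xl
  (divr_gt0 r0 (ltr0Sn _ 1)).
exists (maxn k K) => // i /=; rewrite geq_max => /andP[ki Ki].
have := lK i Ki; rewrite /= => li.
(* Both [x i v] and [x i v0] lie within [r / 4] of [x k v0], and [l] is within [r / 2] of
   [x i v0]. *)
have := kr (i - k)%N v v0; have := kr (i - k)%N v0 v0.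
rewrite subnKC// => h1 h2.
have := metric_triangle l (x i v0) (x i v).
have := metric_triangle (x i v0) (x k v0) (x i v).
rewrite (metric_sym (x k v0)); lra.
Qed.

End midpoint_dynamics.

(** * Recurrence of blocks of independent choices *)

Section recurrence_of_blocks.
Context (R : realType) (d : measure_display) (T : measurableType d).
Context (P : probability T R) (S : Type) (E : nat -> T -> S).
Context (G : nat -> set_system T).
Hypothesis G_sigma : forall k, sigma_algebra setT (G k).
Hypothesis G_measurable : forall k, G k `<=` measurable.
Hypothesis G_mono : forall k, G k `<=` G k.+1.
Hypothesis G_adapted : forall k A, G k.+1 (E k @^-1` A).
Hypothesis E_indep : forall k, independent_of P (E k) (G k).
Context (K : nat -> set S) (p : nat -> R) (L : nat).
Hypothesis E_law : forall k i, (i < L)%N -> P (E k @^-1` K i) = (p i)%:E.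
Hypothesis p_gt0 : forall i, (i < L)%N -> 0 < p i.

Let block k n := [set t | forall i, (i < n)%N -> K i (E (k + i) t)].

Let q := \prod_(i < L) p i.

(** Only the windows starting at [n + j * L] are tested: they are disjoint, so each uses fresh
    draws. *)
Let noblock n m := [set t | forall j, (j < m)%N -> ~ block (n + j * L) L t].

Let G_closed k : [/\ G k setT, setI_closed (G k) & setD_closed (G k)].
Proof.
have [|] := @sigma_algebraP T setT (G k); first by [].
move=> /(_ (G_sigma k))[GT GD _ GI] _; split=> //.
by apply/setD_closedP; split.
Qed.

Let G_le k n : G k `<=` G (k + n).
Proof.
by elim: n => [|n IH] F; [rewrite addn0|move/IH/G_mono; rewrite addnS].
Qed.

Let blockS k n : block k n.+1 = E (k + n) @^-1` K n `&` block k n.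
Proof.
apply/seteqP; split=> t /=; first by move=> h; split=> [|i /leqW]; exact: h.
by move=> [hn h] i; rewrite ltnS leq_eqVlt => /predU1P[->//|]; exact: h.
Qed.

(** The last draw is independent of [G (k + n)], which contains the rest of the event, so each draw
    contributes its factor. The past event [F] is carried along in order to condition on earlier
    windows. *)
Let P_block k n F : (n <= L)%N -> G k F ->
  G (k + n) (block k n `&` F) /\
  P (block k n `&` F) = ((\prod_(i < n) p i)%:E * P F)%E.
Proof.
move=> + GF; elim: n => [_|n IH nL].
  have -> : block k 0 = setT by apply/seteqP; split.
  by rewrite setTI addn0 big_ord0 mul1e.
have [GB PB] := IH (ltnW nL); rewrite blockS -setIA; split.
  have [_ GI _] := G_closed (k + n).+1.
  by rewrite addnS; apply: GI; [exact: G_adapted|exact: G_mono].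
rewrite E_indep// E_law// PB big_ord_recr /= mulrC EFinM muleA.
by rewrite (muleC (_%:E)).
Qed.

(** Given failure in the first [m] windows, the next one still succeeds with probability [q]. *)
Let P_noblock n m : G (n + m * L) (noblock n m) /\
  P (noblock n m) = ((1 - q) ^+ m)%:E.
Proof.
elim: m => [|m [GN PN]].
  have -> : noblock n 0 = setT by apply/seteqP; split.
  rewrite mul0n addn0 probability_setT expr0; split=> //.
  by have [] := G_closed n.
have [GB PB] := P_block (leqnn L) GN.
have -> : noblock n m.+1 =
    noblock n m `\` (block (n + m * L) L `&` noblock n m).
  apply/seteqP; split=> t /=.
    by move=> h; split=> [j /leqW/h//|[/(h m (ltnSn m))]].
  move=> [h hm] j; rewrite ltnS leq_eqVlt => /predU1P[->|/h//] hb.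
  by apply: hm.
split.
  have [_ _ GD] := G_closed (n + m * L + L).
  by rewrite mulSnr addnA; apply: GD => //; exact: G_le.
transitivity (P (noblock n m) -
    P (noblock n m `&` (block (n + m * L) L `&` noblock n m)))%E.
  apply: measureD; [exact: G_measurable GN|exact: G_measurable GB|].
  by rewrite [ltLHS]PN ltry.
rewrite setICA setIid PB PN -EFinM -EFinB exprS; congr (_%:E).
by rewrite /q; ring.
Qed.

Lemma blocks_recur :
  P.-negligible (~` [set t | forall n, exists2 k, (n <= k)%N &
                   forall i, (i < L)%N -> K i (E (k + i) t)]).
Proof.
have q0 : 0 < q by apply: prodr_gt0 => i _; exact: p_gt0.
(* [q] is the probability of a block; thus [1 - q] lies in [[0, 1)] and its powers tend to 0. *)
have q1 : q <= 1.
  have [GT _ _] := G_closed 0.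
  have [/G_measurable mB] := P_block (leqnn L) GT.
  rewrite probability_setT mule1 -lee_fin => <-.
  exact: probability_le1.
pose B n := \bigcap_m noblock n m.
have mB n m : measurable (noblock n m).
  by have [/G_measurable] := P_noblock n m.
(* If no block starts at [n] or later, all windows from [n] on fail. *)
apply: (@negligibleS _ _ _ _ (\bigcup_n B n)).
  move=> t /= /existsNP[n hn]; exists n => // m _ j jm hb; apply: hn.
  by exists (n + j * L)%N => //; rewrite leq_addr.
apply: negligible_bigcup => n.
apply/negligibleP; first exact: bigcapT_measurable.
apply/eqP; rewrite eq_le measure_ge0 andbT; apply/lee_addgt0Pr => r r0.
rewrite add0e.
have : (fun m => (1 - q) ^+ m) @ \oo --> (0 : R).
  by apply: cvg_expr; rewrite ger0_norm; lra.
move=> /cvgrPdist_lt/(_ r r0)[m _ /(_ m (leqnn m))]/=.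
rewrite sub0r normrN => /(le_lt_trans (ler_norm _)) mr.
apply: (@le_trans _ _ (P (noblock n m))).
  apply: le_measure; rewrite ?inE//; first exact: bigcapT_measurable.
  by move=> t; apply.
by have [_ ->] := P_noblock n m; rewrite lee_fin ltW.
Qed.

End recurrence_of_blocks.

(** * Measurability *)

(** The pointwise topology is the supremum of those induced by the evaluations, so each evaluation
    can be treated alone. *)
Lemma ptws_cvg (I : Type) (S : topologicalType) (A : Type) (F : set_system A)
    (FF : Filter F) (f : A -> {ptws I -> S}) (g : {ptws I -> S}) :
  (forall i, (fun a => f a i) @ F --> g i) -> f @ F --> g.
Proof.
move=> fg; apply/cvg_sup => i U [V] [[W] oW <-] Wg WU.
apply: (filterS WU); apply: (fg i); exact: open_nbhs_nbhs.
Qed.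

Section random_limits.
Context (d : measure_display) (T : measurableType d).

(** The sets with measurable preimage form a sigma-algebra. *)
Lemma borel_random_variable (S : topologicalType) (Y : T -> S) :
  (forall U, open U -> measurable (Y @^-1` U)) ->
  is_random_variable (@borel S) Y.
Proof.
move=> mY; rewrite /is_random_variable /borel; apply: smallest_sub => //.
split=> [|A mA|A mA]/=; first by rewrite preimage_set0.
  by rewrite setTD preimage_setC; exact: measurableC.
by rewrite preimage_bigcup; exact: bigcupT_measurable.
Qed.

Lemma measurable_limit (R : realType) (M : metricType R)
    (Y : nat -> T -> M) (Z : T -> M) :
  (forall k A, measurable (Y k @^-1` A)) ->
  (forall t, Y ^~ t @ \oo --> Z t) ->
  forall U, open U -> measurable (Z @^-1` U).
Proof.
move=> mY YZ U oU.
(* Z t is in U iff Y k t is eventually in some V n; the latter need not be open,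
   as all preimages under Y k are measurable. *)
pose V n := [set x : M | ball x n.+1%:R^-1 `<=` U].
have -> : Z @^-1` U =
    \bigcup_n \bigcup_m \bigcap_(k in [set k | (m <= k)%N]) Y k @^-1` V n.
  apply/seteqP; split=> t.
    move=> UZ; have /nbhs_ballP[r /= r0 rU] := open_nbhs_nbhs (conj oU UZ).
    have [n nr] : exists n, n.+1%:R^-1 < r / 2.
      have r20 : 0 < r / 2 by rewrite divr_gt0.
      exists (Num.truncn (r / 2)^-1); rewrite invf_plt ?posrE ?ltr0Sn//.
      exact: truncnS_gt.
    have [m _ mY'] := metricType_numDomainType.cvgr_dist_lt (YZ t)
      (divr_gt0 r0 (ltr0Sn _ 1)).
    exists n => //; exists m => // k mk y; rewrite !ballEmdist/= => ky.
    apply: rU; rewrite ballEmdist/=.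
    have := mY' k mk; have := metric_triangle (Z t) (Y k t) y.
    have {nr ky} := lt_trans ky nr; rewrite /=; lra.
  move=> [n _ [m _ mV]].
  have n0 : 0 < n.+1%:R^-1 :> R by rewrite invr_gt0.
  have [k _ kZ] := metricType_numDomainType.cvgr_dist_lt (YZ t) n0.
  apply: (mV (maxn m k)); rewrite /= ?leq_maxl// ballEmdist/= metric_sym.
  by apply: kZ; rewrite /= leq_maxr.
apply: bigcupT_measurable => n; apply: bigcupT_measurable => m.
by apply: bigcap_measurable => [|k _]; [exists m => /=|exact: mY].
Qed.

(** Splitting over the finitely many values of the last pair reduces to the previous step, so every
    set [A], Borel or not, has a measurable preimage. *)
Lemma measurable_pairwise_midpoint (R : realType) (M : metricType R) (N : nat)
    (x0 : 'I_N -> M) (E : nat -> T -> 'I_N * 'I_N) (k : nat) :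
  (forall k, is_random_variable [set: set ('I_N * 'I_N)] (E k)) ->
  forall A, measurable ((fun t => pairwise_midpoint x0 (E ^~ t) k) @^-1` A).
Proof.
move=> mE; elim: k => [|k IH] A /=; first by rewrite preimage_cst; case: ifP.
pose f (p : 'I_N * 'I_N) (x : {ptws 'I_N -> M}) : {ptws 'I_N -> M} :=
  fun u => if (u == p.1) || (u == p.2) then midpoint (x p.1) (x p.2) else x u.
rewrite [X in measurable X](_ : _ = \bigcup_p (E k.+1 @^-1` [set p] `&`
    (fun t => pairwise_midpoint x0 (E ^~ t) k) @^-1` (f p @^-1` A))).
  apply: fin_bigcup_measurable; first exact: finite_finset.
  by move=> p _; apply: measurableI; [exact: mE|exact: IH].
apply/seteqP; split=> t /=.
  by move=> At; exists (E k.+1 t).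
by move=> [p _ [<-]].
Qed.

End random_limits.

(** * The filtration of past events *)

Lemma past_measurable (d : measure_display) (T : measurableType d)
    (S : topologicalType) (S' : Type) (X : nat -> T -> S) (E : nat -> T -> S')
    (k : nat) :
  (forall i A, measurable (X i @^-1` A)) ->
  (forall i A, measurable (E i @^-1` A)) ->
  past X E k `<=` measurable.
Proof.
move=> mX mE; apply: smallest_sub; first exact: sigma_algebra_measurable.
by move=> F [i _ [[A _ ->]|[A ->]]].
Qed.

Lemma past_mono (T : Type) (S : topologicalType) (S' : Type)
    (X : nat -> T -> S) (E : nat -> T -> S') (k : nat) :
  past X E k `<=` past X E k.+1.
Proof.
by apply: sub_sigma_algebra2 => F [i ik XE]; exists i => //; exact: leqW.
Qed.

Lemma past_adapted (T : Type) (S : topologicalType) (S' : Type)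
    (X : nat -> T -> S) (E : nat -> T -> S') (k : nat) A :
  past X E k.+1 (E k @^-1` A).
Proof. by apply: sub_sigma_algebra; exists k => //; right; exists A. Qed.

(** * Almost sure convergence to a common random limit *)

Theorem theorem1 (R : realType)
  (N : nat) (hN : (2 <= N)%N)
  (e : rel 'I_N) (e_sym : symmetric e) (e_irr : irreflexive e)
  (e_conn : forall v w : 'I_N, connect e v w)
  (M : metricType R) (M_complete : complete_metric M) (M_cat0 : cat0 M)
  (d : measure_display) (T : measurableType d) (P : probability T R)
  (E : nat -> T -> 'I_N * 'I_N)
  (E_rv : forall k, is_random_variable [set: set ('I_N * 'I_N)] (E k))
  (E_iid : iid P E)
  (E_law : forall (k : nat) (v w : 'I_N),
    P (E k @^-1` [set (v, w); (w, v)]) =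
    (if e v w
     then N%:R^-1 * ((degree e v)%:R^-1 + (degree e w)%:R^-1)
     else 0)%:E)
  (x0 : 'I_N -> M)
  (X : nat -> T -> {ptws 'I_N -> M})
  (X_def : forall k t, X k t = pairwise_midpoint x0 (E ^~ t) k)
  (E_past : forall k, independent_of P (E k) (past X E k)) :
  exists Xoo : T -> {ptws 'I_N -> M},
    [/\ is_random_variable (@borel {ptws 'I_N -> M}) Xoo,
        {ae P, forall t, forall v w : 'I_N, Xoo t v = Xoo t w} &
        {ae P, forall t, (X ^~ t) @ \oo --> Xoo t}].
Proof.
pose v0 : 'I_N := Ordinal (leq_trans (ltn0Sn 1) hN).
(* A block is one pass through this list; [K i] accepts both orientations because the law is given
   for unordered pairs. *)
pose l := enum [pred vw : 'I_N * 'I_N | e vw.1 vw.2].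
pose K i : set ('I_N * 'I_N) :=
  let: (v, w) := nth (v0, v0) l i in [set (v, w); (w, v)].
have mX k A : measurable (X k @^-1` A).
  rewrite (_ : X k = fun t => pairwise_midpoint x0 (E ^~ t) k).
    exact: measurable_pairwise_midpoint.
  by apply/funext => t; exact: X_def.
pose p i : R := let: (v, w) := nth (v0, v0) l i in
  N%:R^-1 * ((degree e v)%:R^-1 + (degree e w)%:R^-1).
have le i : (i < size l)%N -> e (nth (v0, v0) l i).1 (nth (v0, v0) l i).2.
  by move=> /(mem_nth (v0, v0)); rewrite mem_enum.
have Kp k i : (i < size l)%N -> P (E k @^-1` K i) = (p i)%:E.
  by move=> /le; rewrite /K /p; case: nth => v w /= vw; rewrite E_law vw.
have degree_gt0 v w : e v w -> (0 < degree e v)%N.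
  by move=> vw; apply/card_gt0P; exists w.
have p_gt0 i : (i < size l)%N -> 0 < p i.
  move=> /le; rewrite /p; case: nth => v w /= vw.
  have wv : e w v by rewrite e_sym.
  rewrite mulr_gt0 ?invr_gt0 ?ltr0n ?(leq_trans _ hN)//.
  by rewrite addr_gt0// invr_gt0 ltr0n;
    [exact: degree_gt0 vw|exact: degree_gt0 wv].
have [B [mB PB recB]] := @blocks_recur R d T P _ E (past X E)
  (fun k => smallest_sigma_algebra _ _)
  (fun k => past_measurable mX (fun i A => E_rv i A I))
  (@past_mono _ _ _ X E) (@past_adapted _ _ _ X E) E_past K p (size l) Kp p_gt0.
have consensus t : ~ B t ->
    exists y : M, forall v, (X k t v @[k --> \oo]) --> y.
  move=> Bt; have rec : forall n, exists2 k, (n <= k)%N &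
      forall i, (i < size l)%N -> K i (E (k + i)%N t).
    by apply: contrapT => nrec; apply: Bt; exact: recB.
  have [|y yt] := @midpoint_consensus R M M_cat0 N x0 (E ^~ t) e e_conn
    (size l) M_complete _ v0; last first.
    by exists y => v; under eq_fun do rewrite X_def; exact: yt.
  (* The pair of index [k + 1] acts on the configuration at time [k], so a block of pairs starting
     at [k + 1] is used; asking for a start at [n + 1] or later excludes index 0. *)
  move=> n; have [[|k]// nk Kk] := rec n.+1; exists k => // v w vw.
  have vwl : (v, w) \in l by rewrite mem_enum.
  exists (index (v, w) l); first by rewrite index_mem.
  have := Kk (index (v, w) l).
  by rewrite index_mem addSn /K nth_index// => /(_ vwl).
(* On the null set [B], the limit [Z] and the orbit [Y] below take a constant value, so that
   convergence holds everywhere and [measurable_limit] applies. *)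
pose Z t := if t \in B then x0 v0
  else xget (x0 v0) [set y : M | forall v, (X k t v @[k --> \oo]) --> y].
have ZE t : ~ B t -> forall v, (X k t v @[k --> \oo]) --> Z t.
  move=> Bt; rewrite /Z; case: ifPn => [/set_mem//|_].
  by have /(xgetPex (x0 v0)) := consensus t Bt.
pose Y k t := if t \in B then x0 v0 else X k t v0.
have mY k A : measurable (Y k @^-1` A).
  rewrite (_ : Y k @^-1` A =
    (B `&` [set _ | A (x0 v0)]) `|` (~` B `&` X k @^-1` [set x | A (x v0)])).
    apply: measurableU; apply: measurableI => //; last exact: measurableC.
    by have [a|a] := pselect (A (x0 v0)); [rewrite (_ : mkset _ = setT)|
      rewrite (_ : mkset _ = set0)] => //; apply/seteqP; split.
  apply/seteqP; split=> t; rewrite /Y /=; case: ifPn => tB.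
  - by left; split=> //; exact: set_mem.
  - by right; split=> //; move/mem_set; exact/negP.
  - by case=> [[]//|[]]; move/set_mem: tB.
  - by case=> [[/mem_set]|[]//]; rewrite (negbTE tB).
have YZ t : Y ^~ t @ \oo --> Z t.
  rewrite /Y; have [tB|tB] := boolP (t \in B).
    have -> : Z t = x0 v0 by rewrite /Z tB.
    exact: cvg_cst.
  by apply: ZE => /mem_set; rewrite (negbTE tB).
have aeB (Q : T -> Prop) : (forall t, ~ B t -> Q t) -> {ae P, forall t, Q t}.
  move=> BQ; exists B; split=> // t /= nQ.
  by apply: contrapT => /BQ.
exists (fun t _ => Z t); split; last 1 first.
- by apply: aeB => t Bt; apply: ptws_cvg => v; exact: ZE.
- apply: borel_random_variable => U oU.
  (* The diagonal embedding is continuous, so open sets of configurations pull back to open sets of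
     [M]. *)
  pose c (y : M) : {ptws 'I_N -> M} := fun _ => y.
  apply: (measurable_limit mY YZ (U := c @^-1` U)).
  by apply: open_comp => // y _; apply: ptws_cvg => v; exact: cvg_id.
- exact: aeB.
Qed.
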